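(* (1) For $m\in\{1,2,3\}$ the matrix $A_m(s)$ is contractive in the maximum norm for every $s>0$. (2) For $m\in\mathbb{N}$, $m\ge4$, and $s>0$, the matrix $A_m(s)$ is contractive in the maximum norm if and only if $$s\le s_m^{(c)}:=\frac{1}{\cosh\omega_m^{(c)}-1},$$ where $\omega_m^{(c)}\in\Big[\log\big((3+\sqrt5+\sqrt{-2+6\sqrt5})/4\big),\ \log3\Big)$ is the unique positive root of the equation $$2\sinh\frac{(m-1)\omega}{4}\,\sinh\frac{(m+1)\omega}{4}=\sinh\frac{\omega}{2}\,\sinh\frac{(m+1)\omega}{2}$$ if $m$ is odd, or of the equation $$\sinh^2\!\Big(\frac{\omega}{2}\Big)\,\sinh\frac{m\omega}{2}\Big(\sinh\frac{(m+2)\omega}{2}-\sinh\frac{m\omega}{2}\Big)=\sinh\omega\;\sinh\frac{(m+1)\omega}{2}\,\sinh\frac{m\omega}{4}\,\sinh\frac{(m-2)\omega}{4}$$ if $m$ is even. (3) The sequence $(s_m^{(c)})_{m\ge4}$ is strictly monotonically decreasing, with all its terms in the interval $\big(3/2,\,1+\sqrt5\,\big]$. As a consequence, the Crank-Nicolson method does not preserve contractivity when the spatial mesh is refined keeping $s$ constant; that is, for fixed $s$, contractivity of $A_m(s)$ in the maximum norm does not in general imply contractivity of $A_{m'}(s)$ for $m'>m$.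
   Context: $\mathbb{N}=\{1,2,3,\dots\}$. For $m\in\mathbb{N}$ and $s>0$ (the CFL coefficient $s=\tau/h^2$ with time step $\tau>0$ and mesh width $h=1/(m+1)$), the Crank-Nicolson iteration matrix for the heat equation $u_t=u_{xx}$ on $[0,1]$ with homogeneous Dirichlet boundary conditions is the $m\times m$ matrix $$A_m(s)=M_m(s)^{-1}N_m(s),$$ where $M_m(s)$ is the $m\times m$ tridiagonal matrix with diagonal entries $1+s$ and sub- and super-diagonal entries $-s/2$, and $N_m(s)$ is the $m\times m$ tridiagonal matrix with diagonal entries $1-s$ and sub- and super-diagonal entries $s/2$. A matrix $A=(a_{ij})$ is called contractive in the maximum norm if $\|A\|_\infty=\max_i\sum_j|a_{ij}|\le1$. *)

(* Defs.v *)
From mathcomp Require Import all_boot all_order all_algebra.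
From mathcomp Require Import all_classical all_reals all_analysis.
Set Implicit Arguments.
Unset Strict Implicit.
Unset Printing Implicit Defensive.
Import Order.TTheory GRing.Theory Num.Theory.
Local Open Scope ring_scope.

Definition sinh (R : realType) (x : R) : R := (expR x - expR (- x)) / 2.
Definition cosh (R : realType) (x : R) : R := (expR x + expR (- x)) / 2.

Definition tridiag (R : realType) (m : nat) (a b : R) : 'M[R]_m :=
  \matrix_(i, j) if i == j then a
                 else if (i.+1 == j :> nat) || (j.+1 == i :> nat) then b
                 else 0.

(* For s > 0 the matrix [tridiag m (1 + s) (- s / 2)] is strictly diagonally
   dominant, hence a unit, so [invmx] is its genuine inverse. *)
Definition crank_nicolson (R : realType) (m : nat) (s : R) : 'M[R]_m :=
  invmx (tridiag m (1 + s) (- s / 2)) *m tridiag m (1 - s) (s / 2).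

(* The seed 0 of the maximum is harmless: all row sums are nonnegative. *)
Definition norm_oo (R : realType) (m : nat) (A : 'M[R]_m) : R :=
  \big[Num.max/0]_(i < m) \sum_(j < m) `|A i j|.

Definition contractive (R : realType) (m : nat) (A : 'M[R]_m) : Prop :=
  norm_oo A <= 1.

Definition critical_equation (R : realType) (m : nat) (w : R) : Prop :=
  if odd m then
    2 * sinh ((m%:R - 1) * w / 4) * sinh ((m%:R + 1) * w / 4)
    = sinh (w / 2) * sinh ((m%:R + 1) * w / 2)
  else
    sinh (w / 2) ^+ 2 * sinh (m%:R * w / 2)
      * (sinh ((m%:R + 2) * w / 2) - sinh (m%:R * w / 2))
    = sinh w * sinh ((m%:R + 1) * w / 2)
      * sinh (m%:R * w / 4) * sinh ((m%:R - 2) * w / 4).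

Definition positive_root (R : realType) (m : nat) (w : R) : Prop :=
  0 < w /\ critical_equation m w.

Definition critical_cfl (R : realType) (w : R) : R := 1 / (cosh w - 1).

(* Main.v *)
Require Import Defs.
From mathcomp Require Import all_boot all_order all_algebra.
From mathcomp Require Import all_classical all_reals all_analysis.
From mathcomp Require Import ring lra zify.
Set Implicit Arguments.
Unset Strict Implicit.
Unset Printing Implicit Defensive.
Import Order.TTheory GRing.Theory Num.Theory.
Import numFieldNormedType.Exports.
Local Open Scope ring_scope.

(** Write M for the matrix inverted in the Crank-Nicolson step, n = m + 1, and
parametrise the CFL coefficient as s = 1 / (cosh (2h) - 1) with h > 0, so that
the frequency of the theorem is w = 2h.

Since the right-hand factor is 2 - M, the iteration matrix is 2 M^-1 - 1.  The
stencil M is a multiple of the second difference with 2 cosh w on the diagonal,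
so M^-1 is the classical Green function in products of hyperbolic sines
([stencil_inv]); it is nonnegative, and its row sums x_i are at most 1
([stencil_inv_rowsum], [profile_le1]).  Only the diagonal entries of
2 M^-1 - 1 can be negative, and the i-th absolute row sum is at most 1 exactly
when x_i <= 2 (M^-1)_ii.  The common factors of these two closed forms cancel
and leave ([contractive_tanh])

  tanh (i h) + tanh ((n - i) h) <= 4 tanh h.

Concavity of tanh makes the middle row the worst one ([tanh_pair_max]), so
contractivity is the single inequality

  tanh (floor (n/2) h) + tanh (ceil (n/2) h) <= 4 tanh h,

and its equality case is, up to positive factors, the critical equation of
either parity ([critical_half_sum]).

By the addition formula, tanh (k h) = tanh h * r_k (q) where q = (tanh h)^2 and
r_k is the rational function defined by r_0 = 0 and
r_(k+1) = (r_k + 1) / (1 + q r_k).  The condition thus becomes G_n (q) <= 4,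
with G_n the sum of the two middle r_k ([half_sum]).  The map
r |-> (r + 1) / (1 + q r) increases in r and decreases in q, which yields the
two facts behind the whole theorem: G_n is strictly decreasing in q for n > 2
([half_sum_decr]), and strictly increasing in n ([half_sum_lt]).  Moreover
G_4 <= 4, G_5 takes the value 4 at q = (2 sqrt 5 - 3) / 11 ([half_sum5]), and
every G_n is below 4 at q = 1/4 because q r_k^2 < 1 ([half_sum_lt4]).  Hence
m <= 3 is always contractive, while for m >= 4 there is a unique critical q,
lying in [(2 sqrt 5 - 3) / 11, 1/4[ and strictly increasing with m.  Finally
s = 1 / (2q) - 1/2 decreases in q and turns these bounds into those on the
critical CFL coefficient, and from there into those on the frequency. *)

(** * Hyperbolic functions *)

Definition tanh (R : realType) (x : R) : R := sinh x / cosh x.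

Section Hyperbolic.
Variable R : realType.
Implicit Types x y : R.

Lemma sinhD x y : sinh (x + y) = sinh x * cosh y + cosh x * sinh y.
Proof. by rewrite /sinh /cosh opprD !expRD; field. Qed.

Lemma coshD x y : cosh (x + y) = cosh x * cosh y + sinh x * sinh y.
Proof. by rewrite /sinh /cosh opprD !expRD; field. Qed.

Lemma sinhN x : sinh (- x) = - sinh x.
Proof. by rewrite /sinh opprK; field. Qed.

Lemma coshN x : cosh (- x) = cosh x.
Proof. by rewrite /cosh opprK addrC. Qed.

Lemma sinhB x y : sinh (x - y) = sinh x * cosh y - cosh x * sinh y.
Proof. by rewrite sinhD sinhN coshN mulrN. Qed.

Lemma coshB x y : cosh (x - y) = cosh x * cosh y - sinh x * sinh y.
Proof. by rewrite coshD sinhN coshN mulrN. Qed.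

Lemma sinh0 : sinh 0 = 0 :> R.
Proof. by rewrite /sinh oppr0 subrr mul0r. Qed.

Lemma cosh_gt0 x : 0 < cosh x.
Proof. by rewrite /cosh divr_gt0 ?addr_gt0 ?expR_gt0. Qed.

Lemma sinh_gt0 x : 0 < x -> 0 < sinh x.
Proof. by move=> x_gt0; rewrite /sinh divr_gt0 ?subr_gt0 ?ltr_expR ?gtrN. Qed.

Lemma sinh_ge0 x : 0 <= x -> 0 <= sinh x.
Proof.
by rewrite le_eqVlt => /predU1P[<-|/sinh_gt0/ltW//]; rewrite sinh0.
Qed.

Lemma cosh2_sinh2 x : cosh x ^+ 2 - sinh x ^+ 2 = 1.
Proof. by rewrite -[RHS](expRxMexpNx_1 x) /cosh /sinh; field. Qed.

Lemma sinhMn2 x : sinh (2 * x) = 2 * sinh x * cosh x.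
Proof. by rewrite mulr_natl mulr2n sinhD; ring. Qed.

Lemma coshMn2 x : cosh (2 * x) = 1 + 2 * sinh x ^+ 2.
Proof.
by have := cosh2_sinh2 x; rewrite mulr_natl mulr2n coshD; lra.
Qed.

Lemma expR_coshDsinh x : expR x = cosh x + sinh x.
Proof. by rewrite /cosh /sinh; field. Qed.

Lemma sinh_lt_cosh x : sinh x < cosh x.
Proof.
have := expR_gt0 (- x); rewrite /sinh /cosh; lra.
Qed.

Lemma tanh_gt0 x : 0 < x -> 0 < tanh x.
Proof. by move=> x_gt0; rewrite divr_gt0 ?sinh_gt0 ?cosh_gt0. Qed.

Lemma tanh_lt1 x : tanh x < 1.
Proof. by rewrite ltr_pdivrMr ?cosh_gt0 // mul1r sinh_lt_cosh. Qed.

Lemma tanhD x y : tanh (x + y) = (tanh x + tanh y) / (1 + tanh x * tanh y).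
Proof.
have cx := cosh_gt0 x; have cy := cosh_gt0 y.
have := cosh_gt0 (x + y).
rewrite /tanh sinhD coshD => cxy; field.
by rewrite !gt_eqF.
Qed.

Lemma tanh_addE x y : tanh x + tanh y = sinh (x + y) / (cosh x * cosh y).
Proof. by rewrite /tanh sinhD; field; rewrite !gt_eqF ?cosh_gt0. Qed.

Lemma tanhK x : ln ((1 + tanh x) / (1 - tanh x)) = 2 * x.
Proof.
have c_neq0 : cosh x != 0 by rewrite gt_eqF ?cosh_gt0.
have -> : (1 + tanh x) / (1 - tanh x) = expR (2 * x).
  have e_neq0 : expR x != 0 by rewrite gt_eqF ?expR_gt0.
  rewrite mulr_natl mulr2n expRD /tanh; move: c_neq0.
  rewrite /sinh /cosh expRN => c_neq0; field; rewrite e_neq0 -expr2 /=.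
  by rewrite gt_eqF ?addr_gt0 ?exprn_gt0 ?expR_gt0 //; apply/eqP; lra.
by rewrite expRK.
Qed.

Lemma tanh_surj (T : R) : 0 < T < 1 ->
  exists2 x, 0 < x & tanh x = T.
Proof.
move=> /andP[T0 T1]; pose X := (1 + T) / (1 - T).
have X1 : 1 < X by rewrite ltr_pdivlMr; lra.
exists (ln X / 2); first by rewrite divr_gt0 // ln_gt0.
have XE : expR (ln X / 2) ^+ 2 = X.
  by rewrite -expRM_natl -mulrC divfK ?lnK ?posrE ?(lt_trans _ X1).
have e_gt0 := expR_gt0 (ln X / 2).
rewrite /tanh /sinh /cosh expRN.
have -> : (expR (ln X / 2) - (expR (ln X / 2))^-1) / 2 /
  ((expR (ln X / 2) + (expR (ln X / 2))^-1) / 2) =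
  (expR (ln X / 2) ^+ 2 - 1) / (expR (ln X / 2) ^+ 2 + 1).
  by field; rewrite !gt_eqF ?addr_gt0 ?exprn_gt0 ?mulr_gt0.
by rewrite XE /X; field; apply/andP; split; apply/eqP; lra.
Qed.

End Hyperbolic.

(** * Quotients of hyperbolic tangents as rational functions *)

Fixpoint tanh_ratio (R : realType) (k : nat) (q : R) : R :=
  if k is k'.+1 then (tanh_ratio k' q + 1) / (1 + q * tanh_ratio k' q) else 0.

(** Up to the factor tanh h, the two hyperbolic tangents met in the middle row of
the matrix of order n - 1; for even n they coincide. *)
Definition half_sum (R : realType) (n : nat) (q : R) : R :=
  tanh_ratio n./2 q + tanh_ratio n.+1./2 q.

Section TanhRatio.
Variable R : realType.
Implicit Types q x : R.

Lemma tanh_ratio_ge0 k q : 0 <= q -> 0 <= tanh_ratio k q.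
Proof.
move=> q_ge0; elim: k => [|k IHk] //=.
by rewrite divr_ge0 ?addr_ge0 ?mulr_ge0.
Qed.

Lemma ratio_denom_gt0 k q : 0 <= q -> 0 < 1 + q * tanh_ratio k q.
Proof. by move=> q0; rewrite ltr_pwDl ?mulr_ge0 ?tanh_ratio_ge0. Qed.

Lemma tanh_ratioE k x : 0 < x ->
  tanh (k%:R * x) = tanh x * tanh_ratio k (tanh x ^+ 2).
Proof.
move=> x_gt0; elim: k => [|k IHk]; first by rewrite mul0r mulr0 /tanh sinh0 mul0r.
rewrite -natr1 mulrDl mul1r tanhD IHk /=.
have := ratio_denom_gt0 k (sqr_ge0 (tanh x)); set r := tanh_ratio _ _ => d_gt0.
by field; rewrite gt_eqF // (_ : _ + _ = 1 + tanh x ^+ 2 * r) //; ring.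
Qed.

Lemma tanh_ratio1 q : tanh_ratio 1 q = 1.
Proof. by rewrite /= mulr0 add0r addr0 divr1. Qed.

Lemma tanh_ratio2 q : tanh_ratio 2 q = 2 / (1 + q).
Proof. by rewrite /= mulr0 add0r addr0 divr1 mulr1. Qed.

(** This is tanh (k h) < 1 when q = (tanh h)^2; the identity in the proof shows
that the bound is preserved by the recursion. *)
Lemma tanh_ratio_bound k q : 0 <= q < 1 -> q * tanh_ratio k q ^+ 2 < 1.
Proof.
move=> /andP[q0 q1]; elim: k => [|k IHk] /=; first by rewrite expr0n mulr0.
have d_gt0 := ratio_denom_gt0 k q0.
rewrite expr_div_n mulrA ltr_pdivrMr ?exprn_gt0 // mul1r -subr_gt0.
set r := tanh_ratio k q in IHk *.
have -> : (1 + q * r) ^+ 2 - q * (r + 1) ^+ 2 = (1 - q) * (1 - q * r ^+ 2) by ring.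
by rewrite mulr_gt0 ?subr_gt0.
Qed.

(** The inequality r_k < r_(k+1) clears denominators to q r_k^2 < 1. *)
Lemma tanh_ratio_ltS k q : 0 <= q < 1 -> tanh_ratio k q < tanh_ratio k.+1 q.
Proof.
move=> q01; have /andP[q0 q1] := q01; have := tanh_ratio_bound k q01.
by have := ratio_denom_gt0 k q0 => d_gt0 b /=; rewrite ltr_pdivlMr //; lra.
Qed.

Lemma tanh_ratio_lt j k q : 0 <= q < 1 -> (j < k)%N ->
  tanh_ratio j q < tanh_ratio k q.
Proof.
move=> q01 jk.
apply: (homo_ltn (f := fun i => tanh_ratio i q) (r := fun x y : R => x < y) _ _ jk).
  by move=> y x z; apply: lt_trans.
by move=> i; apply: tanh_ratio_ltS.
Qed.

(** The recursion step r |-> (r + 1) / (1 + q r) has derivative of the sign of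
1 - q in r and of -r in q; monotonicity of [tanh_ratio] in q follows by
induction. *)
Lemma mobius_step_lt (q q' r r' : R) : 0 <= q -> q <= q' -> q' < 1 ->
  0 < r' -> r' <= r -> (q < q') || (r' < r) ->
  (r' + 1) / (1 + q' * r') < (r + 1) / (1 + q * r).
Proof.
move=> q0 qq' q'1 r'0 rr' strict.
have d (p t : R) : 0 <= p -> 0 < t -> 0 < 1 + p * t.
  by move=> p0 t0; rewrite ltr_pwDl // mulr_ge0 // ltW.
have r0 : 0 < r by apply: lt_le_trans rr'.
have q'0 : 0 <= q' by apply: le_trans qq'.
rewrite ltr_pdivrMr ?d // mulrAC ltr_pdivlMr ?d // -subr_gt0.
have -> : (r + 1) * (1 + q' * r') - (r' + 1) * (1 + q * r) =
  (1 - q) * (r - r') + (q' - q) * r' * (1 + r) by ring.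
have q1 : 0 < 1 - q by lra.
case/orP: strict => lt; [apply: ltr_wpDl | apply: ltr_pwDl].
- by rewrite mulr_ge0 ?subr_ge0 // ltW // -subr_gt0.
- by rewrite !mulr_gt0 ?subr_gt0 // addr_gt0.
- by rewrite mulr_gt0 ?subr_gt0 // -subr_gt0.
- by rewrite !mulr_ge0 ?subr_ge0 ?addr_ge0 // ltW.
Qed.

(** The case k = 1 is excluded because r_1 is constant: the strictness starts with
r_2 = 2 / (1 + q). *)
Lemma tanh_ratio_decr k (q q' : R) : (1 < k)%N -> 0 <= q -> q < q' -> q' < 1 ->
  tanh_ratio k q' < tanh_ratio k q.
Proof.
move=> k1 q0 qq' q'1; have q'0 : 0 <= q' by apply: le_trans (ltW qq').
case: k k1 => // k; elim: k => // -[|k] IHk _.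
  by rewrite !tanh_ratio2 ltr_pM2l ?ltf_pV2 ?posrE; lra.
apply: (@mobius_step_lt _ _ (tanh_ratio k.+2 q)); rewrite ?qq' ?(ltW qq') //;
  last exact/ltW/IHk.
by apply: (@tanh_ratio_lt 0 k.+2 q'); rewrite ?q'0.
Qed.

Lemma tanh_ratio_nincr k (q q' : R) : 0 <= q -> q < q' -> q' < 1 ->
  tanh_ratio k q' <= tanh_ratio k q.
Proof.
move=> q0 qq' q'1; case: k => [|[|k]]; rewrite ?tanh_ratio1 //.
by rewrite ltW ?tanh_ratio_decr.
Qed.

Lemma half_sum_decr n (q q' : R) : (2 < n)%N -> 0 <= q -> q < q' -> q' < 1 ->
  half_sum n q' < half_sum n q.
Proof.
move=> n2 q0 qq' q'1; rewrite /half_sum ler_ltD ?tanh_ratio_nincr //.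
by rewrite tanh_ratio_decr //; lia.
Qed.

(** Passing from n to n + 1 replaces the smaller of the two terms by the successor
of the other one, so a single index grows by one. *)
Lemma half_sum_lt n n' q : 0 <= q < 1 -> (n < n')%N -> half_sum n q < half_sum n' q.
Proof.
move=> q01 nn'.
apply: (homo_ltn (f := fun i => half_sum i q) (r := fun x y : R => x < y) _ _ nn').
  by move=> y x z; apply: lt_trans.
by move=> i; rewrite /half_sum addrC ltrD2l tanh_ratio_lt //; lia.
Qed.

(** From q r^2 < 1 at q = 1/4 each term is below 2.  This is the limit of the
critical condition as n grows, and the origin of log 3 and 3/2. *)
Lemma half_sum_lt4 n : half_sum n (1 / 4) < 4 :> R.
Proof.
have b k : tanh_ratio k (1 / 4) < 2 :> R.
  have q01 : 0 <= (1 / 4 : R) < 1 by apply/andP; split; lra.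
  have := tanh_ratio_bound k q01; have : 0 <= 1 / 4 :> R by lra.
  move=> /(tanh_ratio_ge0 k); nra.
by have := b n./2; have := b n.+1./2; rewrite /half_sum; lra.
Qed.

Lemma continuous_half_sum n (a b : R) : 0 <= a ->
  {within `[a, b], continuous (half_sum n : R -> R)}%classic.
Proof.
move=> a0.
apply: continuous_in_subspaceT => q; rewrite inE /= in_itv /= => /andP[aq _].
have q0 : 0 <= q := le_trans a0 aq.
have c k : {for q, continuous (tanh_ratio k : R -> R)}.
  elim: k => [|k IHk] /=; first exact: cvg_cst.
  apply: cvgM; first by apply: cvgD; [exact: IHk | exact: cvg_cst].
  apply: cvgV; first by rewrite gt_eqF ?ratio_denom_gt0.
  by apply: cvgD; [exact: cvg_cst | apply: cvgM; [exact: cvg_id | exact: IHk]].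
by apply: cvgD; apply: c.
Qed.

End TanhRatio.

(** * The inverse of the stencil and the contractivity criterion *)

Section Green.
Variable R : realType.
Implicit Types (m n i j k : nat) (s w h : R).

(** With indices shifted by one, prescribing zeros at 0 and m + 1 makes the first
and last rows obey the same three-term formula as the others; this is how the
Dirichlet conditions enter. *)
Lemma tridiag_mul m (a b : R) (f : nat -> R) (i : 'I_m) : f 0%N = 0 -> f m.+1 = 0 ->
  \sum_(k < m) tridiag m a b i k * f k.+1 = a * f i.+1 + b * (f i + f i.+2).
Proof.
move=> f0 fm1.
(* Each of the three diagonals selects one value of f; the zeros at both ends
   cover the two values that fall outside the index range. *)
have pick k : (k <= m.+1)%N -> \sum_(l < m) (l.+1 == k :> nat)%:R * f l.+1 = f k.
  case: k => [_|k]; first by rewrite big1 // => l _; rewrite mul0r.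
  rewrite ltnS leq_eqVlt => /predU1P[->|k_lt].
    by rewrite fm1 big1 // => l _; rewrite eqSS ltn_eqF ?mul0r.
  rewrite (bigD1 (Ordinal k_lt)) //= eqxx mul1r big1 ?addr0 // => l l_neq.
  by rewrite eqSS [(l == k :> nat)]negbTE ?mul0r.
have i_lt := ltn_ord i.
rewrite -(pick i.+1) -1?(pick i) -1?(pick i.+2) ?ltnS // 1?ltnW //; last exact: ltnW.
rewrite mulrDr !mulr_sumr -!big_split; apply: eq_bigr => l _ /=.
rewrite mxE !eqSS [(i == l :> 'I_m)]eq_sym -val_eqE [(i.+1 == l :> nat)]eq_sym /=.
have [->|_] := eqVneq (l : nat) i; first by rewrite gtn_eqF // ltn_eqF //=; ring.
have [->|_] := eqVneq (l : nat) i.+1; first by rewrite gtn_eqF //=; ring.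
by case: eqVneq => _ /=; ring.
Qed.

(** Discrete Green function of the Dirichlet problem on 1, ..., n - 1 for the
second difference with coefficient 2 cosh w. *)
Definition green n w i j : R :=
  sinh ((minn i j)%:R * w) * sinh ((n - maxn i j)%:R * w) / (sinh w * sinh (n%:R * w)).

Lemma sinh_rec k w :
  sinh (k.+2%:R * w) = 2 * cosh w * sinh (k.+1%:R * w) - sinh (k%:R * w).
Proof.
have -> : k.+2%:R * w = k.+1%:R * w + w by rewrite -[k.+2%:R]natr1 mulrDl mul1r.
have -> : k%:R * w = k.+1%:R * w - w by rewrite -[k.+1%:R]natr1 mulrDl mul1r addrK.
by rewrite sinhD sinhB; ring.
Qed.

(** Off the diagonal both factors solve the homogeneous recurrence [sinh_rec]; on
the diagonal the residue is the Casoratian of the two solutions, which equals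
the denominator of [green]. *)
Lemma green_equation n w i j : 0 < w -> (i.+1 < n)%N -> (0 < j < n)%N ->
  2 * cosh w * green n w i.+1 j - (green n w i j + green n w i.+2 j) = (i.+1 == j)%:R.
Proof.
move=> w0 i_lt /andP[j0 j_lt].
have nw0 : 0 < sinh (n%:R * w) by rewrite sinh_gt0 // mulr_gt0 // ltr0n; lia.
have sw0 : 0 < sinh w by rewrite sinh_gt0.
rewrite /green; case: eqVneq => [ijE|ij_neq];
  last have [ij|ij] : (i.+1 < j)%N \/ (j < i.+1)%N by lia.
- rewrite -{}ijE {j0 j_lt}.
  have -> : minn i.+1 i.+1 = i.+1 by lia.
  have -> : minn i.+2 i.+1 = i.+1 by lia.
  have -> : minn i i.+1 = i by lia.
  have -> : maxn i.+1 i.+1 = i.+1 by lia.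
  have -> : maxn i.+2 i.+1 = i.+2 by lia.
  have -> : maxn i i.+1 = i.+1 by lia.
  have [l nE] : exists l, n = (i.+1 + l.+1)%N by exists (n - i.+2)%N; lia.
  have -> : (n - i.+1 = l.+1)%N by lia.
  have -> : (n - i.+2 = l)%N by lia.
  move: nw0; rewrite {}nE.
  have -> : i%:R * w = i.+1%:R * w - w by rewrite -[i.+1%:R]natr1 mulrDl mul1r addrK.
  have -> : l%:R * w = l.+1%:R * w - w by rewrite -[l.+1%:R]natr1 mulrDl mul1r addrK.
  rewrite natrD mulrDl !sinhB sinhD => nw0.
  by rewrite [true%:R]/=; field; rewrite !gt_eqF.
- have -> : minn i.+1 j = i.+1 by lia.
  have -> : minn i.+2 j = i.+2 by lia.
  have -> : minn i j = i by lia.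
  have -> : maxn i.+1 j = j by lia.
  have -> : maxn i.+2 j = j by lia.
  have -> : maxn i j = j by lia.
  by rewrite sinh_rec /=; ring.
- have -> : minn i.+1 j = j by lia.
  have -> : minn i.+2 j = j by lia.
  have -> : minn i j = j by lia.
  have -> : (n - maxn i.+1 j)%N = (n - i.+2).+1 by lia.
  have -> : (n - maxn i.+2 j)%N = (n - i.+2)%N by lia.
  have -> : (n - maxn i j)%N = (n - i.+2).+2 by lia.
  by rewrite sinh_rec /=; ring.
Qed.

(** Solution of the Dirichlet problem with constant right-hand side, that is
1 - cosh ((n - 2i) h) / cosh (n h), in the product form whose factors cancel
against those of [green]. *)
Definition profile n h i : R :=
  2 * sinh (i%:R * h) * sinh ((n - i)%:R * h) / cosh (n%:R * h).

Lemma profile_equation n h i : (i.+1 < n)%N ->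
  2 * cosh (2 * h) * profile n h i.+1 - (profile n h i + profile n h i.+2)
  = 4 * sinh h ^+ 2.
Proof.
move=> i_lt; have [l nE] : exists l, n = (i.+1 + l.+1)%N by exists (n - i.+2)%N; lia.
rewrite /profile.
have -> : (n - i = l.+2)%N by lia.
have -> : (n - i.+1 = l.+1)%N by lia.
have -> : (n - i.+2 = l)%N by lia.
rewrite {}nE; have := cosh_gt0 ((i.+1 + l.+1)%:R * h).
have -> : i%:R * h = i.+1%:R * h - h by rewrite -[i.+1%:R]natr1 mulrDl mul1r addrK.
have -> : l%:R * h = l.+1%:R * h - h by rewrite -[l.+1%:R]natr1 mulrDl mul1r addrK.
have -> : i.+2%:R * h = i.+1%:R * h + h by rewrite -[i.+2%:R]natr1 mulrDl mul1r.
have -> : l.+2%:R * h = l.+1%:R * h + h by rewrite -[l.+2%:R]natr1 mulrDl mul1r.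
rewrite natrD mulrDl !sinhB !sinhD coshD coshMn2 => c0.
have -> : 1 + 2 * sinh h ^+ 2 = sinh h ^+ 2 + cosh h ^+ 2.
  by have := cosh2_sinh2 h; lra.
by field; rewrite gt_eqF.
Qed.

Lemma profile_gt0 n h i : 0 < h -> (0 < i < n)%N -> 0 < profile n h i.
Proof.
move=> h0 /andP[i0 i_lt].
have pos k : (0 < k)%N -> 0 < sinh (k%:R * h).
  by move=> k0; rewrite sinh_gt0 // mulr_gt0 // ltr0n.
by rewrite /profile divr_gt0 ?cosh_gt0 // !(pos, mulr_gt0) //; lia.
Qed.

Lemma profile_le1 n h i : 0 < h -> (i <= n)%N -> profile n h i <= 1.
Proof.
move=> h0 i_le; rewrite /profile ler_pdivrMr ?cosh_gt0 // mul1r.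
(* The slack is the term cosh ((n - 2i) h) of the other form of the profile. *)
have -> : n%:R * h = i%:R * h + (n - i)%:R * h by rewrite -mulrDl -natrD subnKC.
rewrite coshD -subr_ge0.
set a := i%:R * h; set b := (n - i)%:R * h.
have -> : cosh a * cosh b + sinh a * sinh b - 2 * sinh a * sinh b = cosh (a - b).
  by rewrite coshB; ring.
exact/ltW/cosh_gt0.
Qed.

Lemma critical_cfl_double h : 0 < h -> critical_cfl (2 * h) = 1 / (2 * sinh h ^+ 2).
Proof. by move=> h0; rewrite /critical_cfl coshMn2 addrAC subrr add0r. Qed.

Section Stencil.
Variables (m : nat) (h : R).
Hypothesis h_gt0 : 0 < h.

Let s := critical_cfl (2 * h).
Let M : 'M[R]_m := tridiag m (1 + s) (- s / 2).

Lemma cfl_gt0 : 0 < s.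
Proof.
by rewrite /s critical_cfl_double // divr_gt0 // mulr_gt0 // exprn_gt0 // sinh_gt0.
Qed.

Lemma cfl_sinh2 : s * (2 * sinh h ^+ 2) = 1.
Proof.
rewrite /s critical_cfl_double // mul1r mulVf // mulf_neq0 // expf_neq0 //.
by rewrite gt_eqF // sinh_gt0.
Qed.

Lemma stencil_mul (f : nat -> R) (i : 'I_m) : f 0%N = 0 -> f m.+1 = 0 ->
  \sum_(k < m) M i k * f k.+1
  = s / 2 * (2 * cosh (2 * h) * f i.+1 - (f i + f i.+2)).
Proof.
move=> f0 fm1; rewrite tridiag_mul // coshMn2.
by rewrite -{1}cfl_sinh2; field.
Qed.

Lemma stencil_green :
  M *m (\matrix_(i, j) (2 / s * green m.+1 (2 * h) i.+1 j.+1)) = 1%:M.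
Proof.
have s0 := cfl_gt0; apply/matrixP => i j.
rewrite !mxE; under eq_bigr => k _ do rewrite [X in _ * X]mxE.
rewrite (stencil_mul (f := fun k => 2 / s * green m.+1 (2 * h) k j.+1)).
- rewrite -val_eqE /= -eqSS -(@green_equation m.+1 (2 * h)) ?mulr_gt0 ?ltnS ?ltn_ord //.
  by field; rewrite gt_eqF.
- by rewrite /green min0n mul0r sinh0 !mul0r mulr0.
- rewrite /green (maxn_idPl _) ?ltnS 1?ltnW // subnn.
  by rewrite [0%:R * _]mul0r sinh0 mulr0 mul0r mulr0.
Qed.

Lemma stencil_inv (i j : 'I_m) :
  invmx M i j = 2 / s * green m.+1 (2 * h) i.+1 j.+1.
Proof.
have [M_unit _] := mulmx1_unit stencil_green.
by rewrite -[invmx M]mulmx1 -stencil_green mulKmx // mxE.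
Qed.

Lemma stencil_inv_rowsum (i : 'I_m) : \sum_j invmx M i j = profile m.+1 h i.+1.
Proof.
have [M_unit _] := mulmx1_unit stencil_green.
pose x : 'cV[R]_m := \col_k profile m.+1 h k.+1.
have Mx : M *m x = const_mx 1.
  apply/colP => k; rewrite !mxE; under eq_bigr => l _ do rewrite [X in _ * X]mxE.
  rewrite (stencil_mul (f := profile m.+1 h)).
  - by rewrite profile_equation ?ltnS // -[RHS]cfl_sinh2; field.
  - by rewrite /profile mul0r sinh0 mulr0 !mul0r.
  - by rewrite /profile subnn [0%:R * _]mul0r sinh0 mulr0 mul0r.
have /colP/(_ i) : invmx M *m const_mx 1 = x by rewrite -Mx mulKmx.
by rewrite !mxE => <-; apply: eq_bigr => j _; rewrite mxE mulr1.
Qed.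

(** By the double-angle formulas the diagonal of the inverse is, up to the factor
2 tanh h, the profile times cosh (i h) cosh ((n - i) h) / sinh (n h), and that
quotient is the inverse of the sum of hyperbolic tangents by [tanh_addE]. *)
Lemma stencil_inv_diag (i : 'I_m) :
  2 * invmx M i i * (tanh (i.+1%:R * h) + tanh ((m.+1 - i.+1)%:R * h))
  = profile m.+1 h i.+1 * (4 * tanh h).
Proof.
have s0 := cfl_gt0; have e := cfl_sinh2; rewrite stencil_inv /green minnn maxnn.
rewrite tanh_addE -mulrDl -natrD subnKC ?ltnS 1?ltnW // /profile.
rewrite ![_ * (2 * h)]mulrCA !sinhMn2 /tanh.
have -> : 2 / s = 4 * sinh h ^+ 2 by rewrite -[2]mulr1 -{1}e; field; rewrite gt_eqF.
have pos k : (0 < k)%N -> 0 < sinh (k%:R * h).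
  by move=> k0; rewrite sinh_gt0 // mulr_gt0 // ltr0n.
by field; rewrite !gt_eqF ?cosh_gt0 ?pos // sinh_gt0.
Qed.

(** Only the i-th term can be negative.  If it is not, the sum is 2 x - 1 with
x <= 1; if it is, the sum is 2 x + 1 - 4 g_i. *)
Lemma row_norm (g : 'I_m -> R) (i : 'I_m) :
  (forall j : 'I_m, 0 <= g j) -> \sum_j g j <= 1 ->
  (\sum_j `|2 * g j - (i == j)%:R| <= 1) = (\sum_j g j <= 2 * g i).
Proof.
move=> g0; rewrite (bigD1 i) //= [X in _ -> X <= _ = _](bigD1 i) //= eqxx.
under [X in _ -> _ + X <= _ = _]eq_bigr => j ji.
  rewrite eq_sym (negbTE ji) subr0 ger0_norm ?mulr_ge0 //; over.
rewrite -mulr_sumr; set S := \sum_(_ | _) _ => /= gS.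
by rewrite -lerBrDr ler_norml; apply/andP/idP => [[]|]; [|move=> ?; split]; lra.
Qed.

Lemma contractive_tanh :
  contractive (crank_nicolson m s) <->
  (forall i, (0 < i < m.+1)%N ->
     tanh (i%:R * h) + tanh ((m.+1 - i)%:R * h) <= 4 * tanh h).
Proof.
have [M_unit _] := mulmx1_unit stencil_green.
have s0 := cfl_gt0.
have AE (i j : 'I_m) : crank_nicolson m s i j = 2 * invmx M i j - (i == j)%:R.
  have NE : tridiag m (1 - s) (s / 2) = 2 *: 1%:M - M.
    apply/matrixP => k l; rewrite !mxE -val_eqE /=.
    by case: eqP => _ /=; [|case: ifP => _]; field.
  by rewrite /crank_nicolson NE mulmxBr mulVmx // -scalemxAr mulmx1 !mxE.
have g0 (i j : 'I_m) : 0 <= invmx M i j.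
  have n0 k : 0 <= sinh (k%:R * (2 * h)) by rewrite sinh_ge0 // !mulr_ge0 // ltW.
  have w0 : 0 <= sinh (2 * h) by rewrite sinh_ge0 // mulr_ge0 // ltW.
  rewrite stencil_inv mulr_ge0 //; first by rewrite divr_ge0 // (ltW s0).
  by rewrite /green divr_ge0 // mulr_ge0.
have rowE (i : 'I_m) : (\sum_j `|crank_nicolson m s i j| <= 1) =
    (tanh (i.+1%:R * h) + tanh ((m.+1 - i.+1)%:R * h) <= 4 * tanh h).
  under eq_bigr => j _ do rewrite AE.
  have x1 : \sum_j invmx M i j <= 1.
    by rewrite stencil_inv_rowsum profile_le1 // ltnS ltnW.
  rewrite row_norm // stencil_inv_rowsum.
  have x0 : 0 < profile m.+1 h i.+1 by rewrite profile_gt0 //= ltnS ltn_ord.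
  rewrite -[RHS](ler_pM2l x0) -stencil_inv_diag ler_pM2r //.
  by rewrite addr_gt0 // tanh_gt0 // mulr_gt0 // ltr0n; have := ltn_ord i; lia.
rewrite /contractive /norm_oo; split=> [/bigmax_leP[_ le1] i|le1].
  case: i => // i /andP[_]; rewrite ltnS => i_lt.
  by rewrite -(rowE (Ordinal i_lt)) le1.
by apply/bigmax_leP; split=> // i _; rewrite rowE le1 //= ltnS ltn_ord.
Qed.

End Stencil.

(** For a fixed sum of arguments the numerator sinh (n h) of [tanh_addE] is fixed,
and the product of hyperbolic cosines is smallest at the middle. *)
Lemma tanh_pair_max n i h : 0 < h -> (i <= n)%N ->
  tanh (i%:R * h) + tanh ((n - i)%:R * h) <=
  tanh (n./2%:R * h) + tanh (n.+1./2%:R * h).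
Proof.
move=> h0; wlog i_le : i / (i <= n./2)%N => [small i_n|_].
  have [|i_gt] := leqP i n./2; first by move/small; apply.
  by rewrite addrC -{2}(subKn i_n) small; lia.
have [d dE] : exists d, n./2 = (i + d)%N by exists (n./2 - i)%N; lia.
set k := n./2 in dE *; set l := n.+1./2.
have -> : (n - i = l + d)%N by lia.
have nE : (k + l = n)%N by lia.
rewrite !tanh_addE -!mulrDl -!natrD (_ : (i + (l + d) = k + l)%N); last by lia.
apply: ler_wpM2l; first by rewrite sinh_ge0 // mulr_ge0 // ltW.
rewrite lef_pV2 ?posrE ?(mulr_gt0 (cosh_gt0 _) (cosh_gt0 _)) // -subr_ge0.
have [e lE] : exists e, l = (k + e)%N by exists (l - k)%N; lia.
have -> : i%:R * h = k%:R * h - d%:R * h by rewrite dE natrD; ring.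
rewrite natrD mulrDl coshB coshD.
have -> : (cosh (k%:R * h) * cosh (d%:R * h) - sinh (k%:R * h) * sinh (d%:R * h)) *
   (cosh (l%:R * h) * cosh (d%:R * h) + sinh (l%:R * h) * sinh (d%:R * h)) -
   cosh (k%:R * h) * cosh (l%:R * h) =
   sinh (d%:R * h) * sinh (d%:R * h + (l%:R * h - k%:R * h)).
  have /(canRL (subrK _)) c2 := cosh2_sinh2 (d%:R * h).
  by rewrite sinhD coshB sinhB; ring: c2.
rewrite lE natrD [(_ + _) * h]mulrDl addrAC subrr add0r -mulrDl -natrD.
by rewrite mulr_ge0 ?sinh_ge0 // mulr_ge0 // ltW.
Qed.

End Green.

(** * The critical CFL coefficient *)

Section CriticalCFL.
Variable R : realType.
Implicit Types (m n k : nat) (q s w h : R).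

Lemma half_sumE n h : 0 < h ->
  tanh (n./2%:R * h) + tanh (n.+1./2%:R * h) = tanh h * half_sum n (tanh h ^+ 2).
Proof. by move=> h0; rewrite !tanh_ratioE // mulrDr. Qed.

Lemma contractive_half_sum m h : (0 < m)%N -> 0 < h ->
  contractive (crank_nicolson m (critical_cfl (2 * h))) <->
  half_sum m.+1 (tanh h ^+ 2) <= 4.
Proof.
move=> m0 h0; have t0 := tanh_gt0 h0.
rewrite contractive_tanh // -(ler_pM2l t0) -half_sumE // [_ * 4]mulrC.
split=> [le4|le4 i /andP[_ i_lt]]; last first.
  by apply: le_trans le4; apply: tanh_pair_max => //; apply: ltnW.
have := le4 m.+1./2; rewrite (_ : (m.+1 - m.+1./2)%N = m.+2./2); last by lia.
by apply; lia.
Qed.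

(** The difference of the two sides of the critical equation is a nonvanishing
product of hyperbolic functions times the defect in the criterion. *)
Lemma critical_half_sum m h : (0 < m)%N -> 0 < h ->
  critical_equation m (2 * h) <-> half_sum m.+1 (tanh h ^+ 2) = 4.
Proof.
move=> m0 h0; have t0 := tanh_gt0 h0.
have sh0 := sinh_gt0 h0; have ch0 := cosh_gt0 h.
have -> : half_sum m.+1 (tanh h ^+ 2) = 4 <->
    tanh (m.+1./2%:R * h) + tanh (m.+2./2%:R * h) - 4 * tanh h = 0.
  rewrite half_sumE // [4 * _]mulrC -mulrBr; split=> [->|/eqP].
    by rewrite subrr mulr0.
  by rewrite mulf_eq0 gt_eqF //= subr_eq0 => /eqP.
have eq0 (x y c d : R) : c != 0 -> x - y = c * d -> (x = y <-> d = 0).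
  move=> /negbTE c0 xy; split=> [/eqP|d0];
    last by apply/eqP; rewrite -subr_eq0 xy d0 mulr0.
  by rewrite -subr_eq0 xy mulf_eq0 c0 /= => /eqP.
rewrite /critical_equation; case: ifP => m_odd.
  have [p mE] : exists p, m = (p.*2.+1)%N by exists m./2; lia.
  have -> : m.+1./2 = p.+1 by lia.
  have -> : m.+2./2 = p.+1 by lia.
  have mR : m%:R = 2 * p.+1%:R - 1 :> R.
    by rewrite mE -!natr1 -addnn natrD; ring.
  set a := p.+1%:R * h.
  have -> : (m%:R - 1) * (2 * h) / 4 = a - h by rewrite mR /a; field.
  have -> : (m%:R + 1) * (2 * h) / 4 = a by rewrite mR /a; field.
  have -> : (m%:R + 1) * (2 * h) / 2 = 2 * a by rewrite mR /a; field.
  have -> : 2 * h / 2 = h by field.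
  have a0 : 0 < a by rewrite /a mulr_gt0 ?ltr0n.
  have sa0 := sinh_gt0 a0; have ca0 := cosh_gt0 a.
  apply: (eq0 _ _ (sinh a * cosh a * cosh h));
    first by do ![exact: lt0r_neq0 | apply: mulf_neq0].
  by rewrite sinhMn2 sinhB /tanh; field; rewrite !gt_eqF.
have [k mE] : exists k, m = k.*2 by exists m./2; lia.
have -> : m.+1./2 = k by lia.
have -> : m.+2./2 = k.+1 by lia.
have mR : m%:R = 2 * k%:R :> R by rewrite mE -addnn natrD; ring.
have -> : k.+1%:R * h = k%:R * h + h by rewrite -natr1; ring.
have : 0 < k%:R * h by rewrite mulr_gt0 // ltr0n; lia.
have -> : (m%:R + 2) * (2 * h) / 2 = k%:R * h + (k%:R * h + h) + h by rewrite mR; field.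
have -> : m%:R * (2 * h) / 2 = 2 * (k%:R * h) by rewrite mR; field.
have -> : (m%:R + 1) * (2 * h) / 2 = k%:R * h + (k%:R * h + h) by rewrite mR; field.
have -> : m%:R * (2 * h) / 4 = k%:R * h by rewrite mR; field.
have -> : (m%:R - 2) * (2 * h) / 4 = k%:R * h - h by rewrite mR; field.
have -> : 2 * h / 2 = h by field.
move: (k%:R * h) => a a0.
have sa0 := sinh_gt0 a0; have ca0 := cosh_gt0 a.
have sah0 := sinh_gt0 (addr_gt0 a0 h0); have cah0 := cosh_gt0 (a + h).
apply: (eq0 _ _
  (- (2 * sinh h * sinh a * cosh a * cosh h * sinh (a + h) * cosh (a + h)))).
  by rewrite oppr_eq0; do ![exact: lt0r_neq0 | apply: mulf_neq0].
(* Both arguments are centred at 2a + h: this keeps the final identity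
   homogeneous in (sinh, cosh) of a and of h, hence true as polynomials. *)
have -> : sinh (a + (a + h) + h) - sinh (2 * a) = 2 * cosh (a + (a + h)) * sinh h.
  rewrite (_ : 2 * a = a + (a + h) - h); last by ring.
  by rewrite sinhB [X in X - _]sinhD; ring.
move: cah0; rewrite !sinhMn2 /tanh !(sinhD, coshD) sinhN coshN => cah0.
by field; rewrite !gt_eqF.
Qed.

Lemma critical_cfl_tanh h : 0 < h ->
  critical_cfl (2 * h) = 1 / (2 * tanh h ^+ 2) - 1 / 2.
Proof.
move=> h0; have sh0 := sinh_gt0 h0; have ch0 := cosh_gt0 h.
rewrite critical_cfl_double // /tanh.
have -> : 1 / (2 * (sinh h / cosh h) ^+ 2) = cosh h ^+ 2 / (2 * sinh h ^+ 2).
  by field; rewrite !gt_eqF.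
have -> : cosh h ^+ 2 = 1 + sinh h ^+ 2 by have := cosh2_sinh2 h; lra.
by field; rewrite gt_eqF.
Qed.

Lemma tanh2_surj q : 0 < q < 1 -> exists2 h, 0 < h & tanh h ^+ 2 = q.
Proof.
move=> /andP[q0 q1]; have [|h h0 hE] := @tanh_surj R (Num.sqrt q).
  by rewrite sqrtr_gt0 q0 -[X in _ < X]sqrtr1 ltr_sqrt.
by exists h => //; rewrite hE sqr_sqrtr // ltW.
Qed.

Lemma tanh2_inj h h' : 0 < h -> 0 < h' -> tanh h ^+ 2 = tanh h' ^+ 2 -> h = h'.
Proof.
move=> h0 h'0 /eqP; rewrite eqrXn2 ?ltW ?tanh_gt0 // => /eqP hh'.
by have := tanhK h; rewrite hh' tanhK; lra.
Qed.

Lemma tanh2_itv h : 0 < h -> 0 < tanh h ^+ 2 < 1.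
Proof.
by move=> h0; rewrite exprn_gt0 ?tanh_gt0 // exprn_ilt1 ?tanh_lt1 // ltW ?tanh_gt0.
Qed.

Lemma cfl_surj s : 0 < s -> exists2 h, 0 < h & s = critical_cfl (2 * h).
Proof.
move=> s0; have d0 : 0 < 1 + 2 * s by lra.
have [|h h0 hE] := @tanh2_surj (1 / (1 + 2 * s)).
  by rewrite divr_gt0 //= ltr_pdivrMr //; lra.
by exists h => //; rewrite critical_cfl_tanh // hE; field; rewrite gt_eqF.
Qed.

Lemma critical_cfl_le h h' : 0 < h -> 0 < h' ->
  (critical_cfl (2 * h) <= critical_cfl (2 * h')) = (tanh h' ^+ 2 <= tanh h ^+ 2).
Proof.
move=> h0 h'0; rewrite !critical_cfl_tanh // lerD2r !div1r.
have [/andP[t0 _] /andP[t'0 _]] := (tanh2_itv h0, tanh2_itv h'0).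
by rewrite lef_pV2 ?posrE ?ler_pM2l 1?pmulr_rgt0.
Qed.

(** The value of (tanh h)^2 at criticality for m = 4: the positive root of
11 q^2 + 6 q - 1, which is the numerator of 4 - G_5 (q). *)
Definition first_critical_ratio : R := (2 * Num.sqrt 5 - 3) / 11.

Lemma sqrt5 : Num.sqrt 5 ^+ 2 = 5 :> R.
Proof. exact: sqr_sqrtr. Qed.

Lemma sqrt5_bounds : 2 < (Num.sqrt 5 : R) < 5 / 2.
Proof.
have s0 : 0 <= Num.sqrt 5 :> R by apply: sqrtr_ge0.
by have s5 := sqrt5; apply/andP; split; nra.
Qed.

Lemma half_sum5 : half_sum 5 first_critical_ratio = 4.
Proof.
have /andP[l u] := sqrt5_bounds.
have qE : 11 * first_critical_ratio ^+ 2 + 6 * first_critical_ratio - 1 = 0.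
  by have := sqrt5; rewrite /first_critical_ratio => s5; field: s5.
have : 0 < first_critical_ratio by rewrite divr_gt0 //; lra.
move: first_critical_ratio qE => q qE q0.
rewrite /half_sum /= !(mulr0, add0r, addr0, divr1, mulr1).
have -> : 1 + 1 = 2 :> R by [].
suff : 2 / (1 + q) + (2 / (1 + q) + 1) / (1 + q * (2 / (1 + q))) - 4 =
    - (11 * q ^+ 2 + 6 * q - 1) / ((1 + q) * (1 + 3 * q)).
  by rewrite qE oppr0 mul0r; lra.
by field; rewrite !gt_eqF //; lra.
Qed.

(** Intermediate value theorem between the critical point of n = 5, where larger n
only increase the sum, and q = 1/4. *)
Lemma critical_ratio n : (4 < n)%N ->
  exists2 q, first_critical_ratio <= q < 1 / 4 & half_sum n q = 4.
Proof.
move=> n4; have /andP[l u] := sqrt5_bounds.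
have q0 : 0 < first_critical_ratio by rewrite divr_gt0 //; lra.
have q41 : first_critical_ratio < 1 / 4 by rewrite /first_critical_ratio; lra.
have ge4 : 4 <= half_sum n first_critical_ratio.
  move: n4; rewrite leq_eqVlt => /predU1P[<-|n5]; first by rewrite half_sum5.
  by rewrite -{1}half_sum5 ltW // half_sum_lt // ltW //=; lra.
have lt4 := @half_sum_lt4 R n.
have [||c] := @IVT R (half_sum n) first_critical_ratio (1 / 4) 4 (ltW q41).
- exact: (continuous_half_sum (ltW q0)).
- by rewrite ge_min le_max ge4 (ltW lt4) orbT.
rewrite in_itv /= => /andP[c1 c2] cE; exists c => //.
rewrite c1 lt_neqAle c2 andbT; apply: contra_ltN lt4 => /eqP <-.
by rewrite cE.
Qed.

(** The bounds on the CFL coefficient say (3 + sqrt 5) / 4 <= cosh w < 5/3, and the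
two logarithms are the inverse hyperbolic cosines of these numbers. *)
Lemma frequency_itv w :
  0 < w -> 3 / 2 < critical_cfl w -> critical_cfl w <= 1 + Num.sqrt 5 ->
  w \in `[ln ((3 + Num.sqrt 5 + Num.sqrt (- 2 + 6 * Num.sqrt 5)) / 4), ln 3[.
Proof.
move=> w0; have /andP[l u] := sqrt5_bounds; have s5 := sqrt5.
have c1 : 0 < cosh w - 1.
  have -> : w = 2 * (w / 2) by field.
  by rewrite coshMn2 addrAC subrr add0r pmulr_rgt0 // exprn_gt0 // sinh_gt0 // divr_gt0.
rewrite /critical_cfl ltr_pdivlMr // ler_pdivrMr // => cu cl.
have sw0 := sinh_gt0 w0; have cs := cosh2_sinh2 w.
have eE := expR_coshDsinh w.
have sq0 := sqrtr_ge0 (- 2 + 6 * Num.sqrt 5 : R).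
rewrite in_itv /=; apply/andP; split.
  have X0 : 0 < (3 + Num.sqrt 5 + Num.sqrt (- 2 + 6 * Num.sqrt 5)) / 4 :> R by lra.
  rewrite -[leRHS]expRK ler_ln ?posrE ?expR_gt0 //.
  rewrite eE ler_pdivrMr //.
  have cl' : (3 + Num.sqrt 5) / 4 <= cosh w by nra.
  suff : Num.sqrt (- 2 + 6 * Num.sqrt 5) <= 4 * sinh w by lra.
  have -> : 4 * sinh w = Num.sqrt ((4 * sinh w) ^+ 2).
    by rewrite sqrtr_sqr ger0_norm //; lra.
  by rewrite ler_wsqrtr //; nra.
rewrite -[ltLHS]expRK ltr_ln ?posrE ?expR_gt0 //.
rewrite eE; nra.
Qed.

Lemma critical_half_angle m : (4 <= m)%N ->
  exists h, [/\ 0 < h, first_critical_ratio <= tanh h ^+ 2 < 1 / 4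
              & half_sum m.+1 (tanh h ^+ 2) = 4].
Proof.
move=> m4; have [q /andP[q_ge q_lt] qE] := @critical_ratio m.+1 m4.
have /andP[l u] := sqrt5_bounds.
have [|h h0 hE] := @tanh2_surj q.
  by move: q_ge; rewrite /first_critical_ratio; lra.
by exists h; rewrite hE q_ge q_lt.
Qed.

Lemma half_sum_inj n q q' : (2 < n)%N -> 0 <= q < 1 -> 0 <= q' < 1 ->
  half_sum n q = half_sum n q' -> q = q'.
Proof.
move=> n2 /andP[q0 q1] /andP[q'0 q'1] E.
case: (ltgtP q q') => // lt.
  by have := half_sum_decr n2 q0 lt q'1; rewrite E ltxx.
by have := half_sum_decr n2 q'0 lt q1; rewrite E ltxx.
Qed.

Lemma half_sum_le n q q' : (2 < n)%N -> 0 <= q < 1 -> 0 <= q' < 1 ->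
  (half_sum n q <= half_sum n q') = (q' <= q).
Proof.
move=> n2 /andP[q0 q1] /andP[q'0 q'1].
case: (ltgtP q q') => [lt|lt|->]; last exact: lexx.
  by apply: lt_geF; apply: half_sum_decr.
by apply/ltW/half_sum_decr.
Qed.

(** The sum grows with n, and G_4 (q) = 4 / (1 + q). *)
Lemma half_sum_le4 n q : (n <= 4)%N -> 0 <= q < 1 -> half_sum n q <= 4.
Proof.
move=> n4 q01; have /andP[q0 q1] := q01.
have le4 : half_sum 4 q <= 4.
  have -> : half_sum 4 q = 2 / (1 + q) + 2 / (1 + q) by rewrite -tanh_ratio2.
  by rewrite -mulrDl ler_pdivrMr; lra.
move: n4; rewrite leq_eqVlt => /predU1P[->//|/half_sum_lt lt].
by apply: le_trans le4; rewrite ltW // lt.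
Qed.

End CriticalCFL.

Theorem theorem2 (R : realType) :
  (forall m : nat, m \in [:: 1; 2; 3]%N ->
     forall s : R, 0 < s -> contractive (crank_nicolson m s)) /\
  (exists omega : nat -> R,
     (forall m : nat, (4 <= m)%N ->
        [/\ unique (positive_root m) (omega m),
            omega m \in `[ln ((3 + Num.sqrt 5 + Num.sqrt (- 2 + 6 * Num.sqrt 5)) / 4),
                          ln 3[
          & forall s : R, 0 < s ->
              (contractive (crank_nicolson m s) <-> s <= critical_cfl (omega m))]) /\
     (forall m m' : nat, (4 <= m)%N -> (m < m')%N ->
        critical_cfl (omega m') < critical_cfl (omega m)) /\
     (forall m : nat, (4 <= m)%N ->
        critical_cfl (omega m) \in `]3 / 2, 1 + Num.sqrt 5])) /\
  (exists (s : R) (m m' : nat),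
     [/\ 0 < s, (1 <= m)%N, (m < m')%N,
         contractive (crank_nicolson m s)
       & ~ contractive (crank_nicolson m' s)]).
Proof.
have tanh01 h : 0 < h -> 0 <= tanh h ^+ 2 < 1.
  by move=> /tanh2_itv/andP[/ltW -> ->].
have small m : (0 < m <= 3)%N ->
    forall s : R, 0 < s -> contractive (crank_nicolson m s).
  move=> /andP[m0 m3] s /cfl_surj[h h0 ->].
  by apply/(contractive_half_sum m0 h0)/half_sum_le4; rewrite ?tanh01.
have /choice[half_angle half_angleP] (m : nat) : exists h : R, (4 <= m)%N ->
    [/\ 0 < h, first_critical_ratio R <= tanh h ^+ 2 < 1 / 4
      & half_sum m.+1 (tanh h ^+ 2) = 4].
  have [m4|_] := leqP 4 m; last by exists 0.
  by have [h hP] := critical_half_angle R m4; exists h.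
have cfl_itv m : (4 <= m)%N ->
    critical_cfl (2 * half_angle m) \in `]3 / 2, 1 + Num.sqrt 5].
  move=> /half_angleP[h0 /andP[q_ge q_lt] _]; have /andP[q0 _] := tanh2_itv h0.
  have /andP[l u] := sqrt5_bounds R; have s5 := sqrt5 R.
  rewrite in_itv /= critical_cfl_tanh // ltrBrDr lerBlDr.
  move: q_ge; rewrite /first_critical_ratio => q_ge.
  rewrite ltr_pdivlMr ?ler_pdivrMr 1?pmulr_rgt0 //.
  by apply/andP; split; nra.
have contractiveP m : (4 <= m)%N -> forall s : R, 0 < s ->
    (contractive (crank_nicolson m s) <-> s <= critical_cfl (2 * half_angle m)).
  move=> m4 s /cfl_surj[h h0 ->]; have [h'0 _ E] := half_angleP m m4.
  rewrite contractive_half_sum //; last by lia.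
  by rewrite critical_cfl_le // -[4]E half_sum_le ?tanh01 //; lia.
split; first by move=> m; rewrite !inE => /or3P[] /eqP ->; apply: small.
split.
  exists (fun m => 2 * half_angle m); split; last split; last exact: cfl_itv.
    move=> m m4; have [h0 _ E] := half_angleP m m4.
    have w0 : 0 < 2 * half_angle m by rewrite pmulr_rgt0.
    split; last exact: contractiveP.
      split; first by split=> //; apply/critical_half_sum => //; lia.
      move=> w [w_gt0 wE]; have wh : w = 2 * (w / 2) by field.
      have h'0 : 0 < w / 2 by rewrite divr_gt0.
      rewrite wh; congr (2 * _); apply: tanh2_inj => //.
      apply: (@half_sum_inj _ m.+1); rewrite ?tanh01 //; first by lia.
      by rewrite E; apply/esym/critical_half_sum; rewrite -?wh //; lia.
    by have := cfl_itv m m4; rewrite in_itv /= => /andP[? ?]; apply: frequency_itv.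
  move=> m m' m4 mm'; have m'4 : (4 <= m')%N by lia.
  have [[h0 _ E] [h'0 _ E']] := (half_angleP m m4, half_angleP m' m'4).
  rewrite ltNge critical_cfl_le // -ltNge.
  rewrite ltNge -(@half_sum_le _ m'.+1) ?tanh01 //; last by lia.
  by rewrite -ltNge E' -E half_sum_lt ?tanh01.
(* Just above the threshold of m = 4 the smaller system m = 3 is contractive. *)
have := cfl_itv 4 isT; rewrite in_itv /= => /andP[cfl_gt _].
exists (critical_cfl (2 * half_angle 4) + 1), 3, 4.
have s0 : 0 < critical_cfl (2 * half_angle 4) + 1 by lra.
split=> //; first exact: small.
by rewrite contractiveP //; lra.
Qed.
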